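(* Let $r>1$. There is a constant $C_r>0$ depending only on $r$ such that the following holds. Let $A=(A(k,l))_{k,l\in\mathbb{Z}}$ be an infinite matrix that satisfies $$|A(k,l)|\le C\,(1+|k-l|)^{-r}\qquad\text{for all }k,l\in\mathbb{Z},$$ where $C$ is the minimal constant for which this holds, and suppose that $A$ is (boundedly) invertible on $\ell^2(\mathbb{Z})$. Then $$|A^{-1}(k,l)|\le C_r\, C^{\,2r+2+\frac{2}{r-1}}\,\|A^{-1}\|_{\mathcal{B}(\ell^2)}^{\,2r+3+\frac{2}{r-1}}\,(1+|k-l|)^{-r}\qquad\text{for all }k,l\in\mathbb{Z}.$$
   Context: Matrices indexed by $\mathbb{Z}\times\mathbb{Z}$ act on $\ell^2(\mathbb{Z})$ by matrix-vector multiplication; $A^{-1}(k,l)$ are the matrix entries of the inverse operator with respect to the standard basis; $\|\cdot\|_{\mathcal{B}(\ell^2)}$ is the operator norm on $\ell^2(\mathbb{Z})$. *)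

(* Defs.v *)
From HB Require Import structures.
From mathcomp Require Import all_boot all_order all_algebra.
From mathcomp Require Import finmap complex.
From mathcomp Require Import all_classical all_reals all_analysis.
From mathcomp Require Import ring.
From mathcomp Require summability.

Set Implicit Arguments.
Unset Strict Implicit.
Unset Printing Implicit Defensive.

Import Order.TTheory GRing.Theory Num.Theory Normc.

Local Open Scope classical_set_scope.
Local Open Scope ring_scope.

(* On [R[i]], the norm [`|z|] is [R[i]]-valued; [normc z] is the same modulus
   as an element of [R]. *)

Section SquareSummable.
Variable R : realType.
Implicit Types f g : int -> R[i].

Definition sqr_sum f : \bar R :=
  (\esum_(k in [set: int]) (normc (f k) ^+ 2)%:E)%E.

Definition square_summable : {pred int -> R[i]} :=
  [pred f | (sqr_sum f < +oo)%E].

Fact square_summable_submod : submod_closed square_summable.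
Proof.
split.
  rewrite inE /= /sqr_sum esum1 ?ltry// => k _.
  by rewrite [normc _]normc0 expr0n.
move=> a f g; rewrite !inE /= => hf hg.
have nn (h : int -> R[i]) k : (0 <= (normc (h k) ^+ 2)%:E)%E.
  by rewrite lee_fin sqr_ge0.
have hZ : (sqr_sum (a *: f) < +oo)%E.
  apply: (@le_lt_trans _ _ ((normc a ^+ 2)%:E * sqr_sum f)%E); last first.
    by rewrite lte_mul_pinfty// lee_fin sqr_ge0.
  apply: ge_ereal_sup => _ /= [F hF <-].
  rewrite (_ : (\sum_(x \in F) _)%R =
     ((normc a ^+ 2)%:E * (\sum_(k \in F) (normc (f k) ^+ 2)%:E)%R)%E).
    rewrite lee_wpmul2l ?lee_fin ?sqr_ge0//.
    by apply: ereal_sup_ubound; exists F.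
  rewrite ge0_mule_fsumr//; apply: eq_fsbigr => k _.
  by rewrite -EFinM -exprMn -normcM.
apply: (@le_lt_trans _ _
    ((sqr_sum (a *: f) + sqr_sum (a *: f)) + (sqr_sum g + sqr_sum g))%E).
  rewrite /sqr_sum -!esumD// ?le_esum//= => [k _|k _|k _]; try exact: adde_ge0.
  rewrite -!EFinD lee_fin [(_ + _) k]/=.
  set x := (a *: f) k; set y := g k.
  have nc0 (z : R[i]) : 0 <= normc z by case: z => u v; exact: sqrtr_ge0.
  have tri : normc (x + y) <= normc x + normc y by exact: le_normcD.
  have := lerXn2r 2 (nc0 _ : _ \in Num.nneg)
    (addr_ge0 (nc0 _) (nc0 _) : _ \in Num.nneg) tri.
  move=> /le_trans; apply; rewrite -subr_ge0.
  rewrite (_ : _ - _ = (normc x - normc y) ^+ 2) ?sqr_ge0//.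
  by rewrite sqrrD sqrrB !mulr2n !opprD; ring.
by rewrite !lte_add_pinfty.
Qed.

HB.instance Definition _ :=
  GRing.isSubmodClosed.Build _ _ square_summable square_summable_submod.

Lemma delta_square_summable (l : int) :
  (fun k => (k == l)%:R : R[i]) \in square_summable.
Proof.
rewrite inE /= /sqr_sum (esumID [set l])//; last first.
  by move=> k _; rewrite lee_fin sqr_ge0.
rewrite setTI setTI esum_set1 ?lee_fin ?sqr_ge0// [X in (_ + X)%E]esum1 ?adde0 ?ltry//.
by move=> k /= /eqP/negPf ->; rewrite [normc _]normc0 expr0n.
Qed.

End SquareSummable.

Section Ell2.
Variable R : realType.

Record ell2 := Ell2 {
  ell2_fun :> int -> R[i];
  _ : ell2_fun \in @square_summable R }.

HB.instance Definition _ := [isSub for ell2_fun].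
HB.instance Definition _ := [Choice of ell2 by <:].
HB.instance Definition _ := [SubChoice_isSubLmodule of ell2 by <:].

Definition ell2_norm (f : ell2) : R := Num.sqrt (fine (sqr_sum f)).

Definition ell2_delta (l : int) : ell2 := Ell2 (delta_square_summable R l).

Definition bounded_op (T : ell2 -> ell2) :=
  exists M : R, forall f, ell2_norm (T f) <= M * ell2_norm f.

Definition op_norm (T : ell2 -> ell2) : R :=
  sup [set ell2_norm (T f) | f in [set f | ell2_norm f <= 1]].

(* The matrix coefficient <T e_l, e_k>. *)
Definition op_entry (T : ell2 -> ell2) (k l : int) : R[i] :=
  T (ell2_delta l) k.

(* [S f = A f] for all [f], each row sum [\sum_l A k l * f l] being an
   unconditional sum, i.e. a limit along the net of finite subsets of [int]. *)
Definition acts_as (A : int -> int -> R[i]) (S : ell2 -> ell2) :=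
  forall (f : ell2) (k : int),
    summability.partial_sum (fun l => A k l * f l) F
      @[F --> summability.totally] --> (S f k : R[i]^o).

(* [A] defines an operator on l^2, whose bounded two-sided inverse is [T]. *)
Definition bounded_inverse (A : int -> int -> R[i]) (T : {linear ell2 -> ell2}) :=
  bounded_op T /\
  exists S : ell2 -> ell2, [/\ acts_as A S, cancel S T & cancel T S].

Definition off_diagonal_decay (r : R) (A : int -> int -> R[i]) (C : R) :=
  forall k l : int, normc (A k l) <= C * (1 + `|k - l|%:~R) `^ (- r).

Definition minimal_decay_constant (r : R) (A : int -> int -> R[i]) (C : R) :=
  off_diagonal_decay r A C /\
  forall C' : R, off_diagonal_decay r A C' -> C <= C'.

End Ell2.

(* Main.v *)
Require Import Defs.
From mathcomp Require Import all_boot all_order all_algebra.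
From mathcomp Require Import finmap complex all_classical all_reals all_analysis.
From mathcomp Require Import ring lra zify.
From mathcomp Require summability.

(** Fix a column [f = Ainv e_l] of the inverse, and let [M] be the norm of the
    inverse, so that [|g| <= M |A g|] for all [g] in l^2.  Let [psi_n] be the
    tent function of height 1 centred at [n] and of half-width [N], and apply
    this bound to [g = psi_n f].  Since [A f = e_l],
      [A (psi_n f) = psi_n(l) e_l + [A, psi_n] f],
    and everything rests on the fact that the commutator is small when [N] is
    large.  Its entries are bounded by
      [|psi_n(k) - psi_n(j)| C (1 + |k-j|)^-r
         <= 9^r C q_n(k) q_n(j) (N^-d (1 + |k-j|)^-(r-d) + N^-r)],
    where [q_n(j) = (1 + |j-n|/N)^-r] and [d = (r-1)/(2r)]
    ([tent_commutator]): each exponent is still summable, a factor [N^-d] has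
    been gained, and [q_n] keeps track of the distance to [n] at scale [N].

    Let [x(n) = |psi_n f|], and suppose that [x <= u] for a profile
    [u = a q_l + b].  Profiles behave well under averaging against [q_n]:
    [q_n u <= u(n)] pointwise and the sum of [q_n u] is [O(N u(n))], because
    the decay [q_l] is preserved by convolution.  A weighted Schur test with
    weight [u] therefore gives [|[A, psi_n] f| <= const C N^-d u(n)]
    ([commutator_energy]); the local masses of [f] enter it only through the
    [x(m)], after averaging over all windows ([esum_window]).  With
    [N^d = const C M] the energy inequality becomes
      [x^2 <= 2 M^2 psi_n(l)^2 + u^2/4],
    and if [a = 4 2^r M] this yields [x <= a q_l + b/2]
    ([cutoff_contraction]).  Starting from [x <= |f| <= M] and iterating, the
    constant term disappears in the limit: [|f(k)| <= x(k) <= a q_l(k)].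

    Finally [q_l(k) <= N^r (1 + |k-l|)^-r], so that the loss is
    [N^r = (const C M)^(r/d)], and [r/d = 2r^2/(r-1) = 2r + 2 + 2/(r-1)] is the
    exponent of the theorem, one more factor [M] coming from [a].  The scale
    must satisfy [N >= 1]; this is possible because [C M] is bounded below by a
    constant depending on [r] ([norm_product_ge]). *)

Import Order.TTheory GRing.Theory Num.Theory Normc.

Set Implicit Arguments.
Unset Strict Implicit.
Unset Printing Implicit Defensive.

Local Open Scope classical_set_scope.
Local Open Scope ring_scope.

(** * Sums over the integers *)

Section Sums.
Context {R : realType}.

Lemma le_of_eq (x y : R) : x = y -> x <= y.
Proof. by move=> ->. Qed.

Lemma esumZl {T : choiceType} (I : set T) (c : R) (a : T -> \bar R) :
  0 <= c -> (forall i, (0 <= a i)%E) ->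
  (\esum_(i in I) (c%:E * a i) = c%:E * \esum_(i in I) a i)%E.
Proof.
have le_esumZl d (b : T -> \bar R) : 0 <= d -> (forall i, (0 <= b i)%E) ->
    (\esum_(i in I) (d%:E * b i) <= d%:E * \esum_(i in I) b i)%E.
  move=> d0 b0; apply: ge_ereal_sup => _ [F hF <-].
  rewrite -ge0_mule_fsumr// lee_wpmul2l ?lee_fin//.
  by apply: ereal_sup_ubound; exists F.
move=> c0 a0; apply/le_anti/andP; split; first exact: le_esumZl.
have [->|cN0] := eqVneq c 0.
  by rewrite mul0e esum_ge0// => i _; rewrite mul0e.
rewrite -lee_pdivlMl ?lt_neqAle 1?eq_sym ?cN0//.
apply: le_trans (le_esumZl _ _ _ _); rewrite ?invr_ge0//; last first.
  by move=> i; rewrite mule_ge0.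
by apply: le_esum => i _; rewrite muleA -EFinM mulVf// mul1e.
Qed.

Lemma exchange_esum {T1 T2 : choiceType} (I : set T1) (J : set T2)
    (a : T1 -> T2 -> \bar R) : (forall i j, (0 <= a i j)%E) ->
  \esum_(i in I) \esum_(j in J) a i j = \esum_(j in J) \esum_(i in I) a i j.
Proof.
move=> a0; rewrite !esum_esum//.
rewrite (reindex_esum (J `*`` (fun=> I))%classic _ (fun x => (x.2, x.1)))//.
split=> //=.
- by move=> [i j] [/=].
- by move=> [i1 i2] [j1 j2] /= _ _ [] -> ->.
- by move=> [i1 i2] [? ?] /=; exists (i2, i1).
Qed.

Lemma esum_nat_le (a : nat -> R) (c : R) : (forall i, 0 <= a i) ->
  (forall m, \sum_(0 <= i < m) a i <= c) ->
  (\esum_(i in [set: nat]) (a i)%:E <= c%:E)%E.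
Proof.
move=> a0 ac; rewrite -nneseries_esumT => [|i]; last by rewrite lee_fin.
apply: lime_le; first by apply: is_cvg_nneseries => i _ _; rewrite lee_fin.
by apply: nearW => m /=; rewrite sumEFin lee_fin.
Qed.

Lemma esum_int_split (n : int) (a : int -> \bar R) : (forall i, (0 <= a i)%E) ->
  (\esum_(i in [set: int]) a i =
   \esum_(i in [set: nat]) a (n + i%:Z)%R + \esum_(i in [set: nat]) a (n - i.+1%:Z)%R)%E.
Proof.
move=> a0; rewrite (esumID [set j | n <= j]%classic)// !setTI.
congr (_ + _)%E; apply: reindex_esum; split=> //=.
- by move=> i _ /=; lia.
- by move=> i j _ _ /=; lia.
- by move=> j /= nj; exists `|j - n|%N => //; lia.
- by move=> i _ /=; lia.
- by move=> i j _ _ /=; lia.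
- by move=> j /= nj; exists `|n - j|%N.-1 => //; lia.
Qed.
End Sums.

(** * Polynomially decaying kernels *)

Section Decay.
Context {R : realType}.
Implicit Types (p s t N x y c : R) (i j k n : int).

Definition dist k j : R := `|k - j|%:~R.

Definition decay s N k j : R := (1 + dist k j / N) `^ (- s).

Definition decay_mass s : R := 1 + 2 / (s - 1).

Lemma dist_ge0 k j : 0 <= dist k j.
Proof. by rewrite ler0z. Qed.

Lemma dist_sym k j : dist k j = dist j k.
Proof. by rewrite /dist distrC. Qed.

Lemma dist_tri i j k : dist i k <= dist i j + dist j k.
Proof. by rewrite /dist -intrD ler_int; lia. Qed.

Lemma distxx k : dist k k = 0.
Proof. by rewrite /dist subrr. Qed.

Lemma base_gt0 N k j : 0 < N -> 0 < 1 + dist k j / N.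
Proof. by move=> N0; rewrite ltr_pwDl// divr_ge0 ?dist_ge0// ltW. Qed.

Lemma decay_gt0 s N k j : 0 < N -> 0 < decay s N k j.
Proof. by move=> N0; rewrite powR_gt0// base_gt0. Qed.

Lemma decay_ge0 s N k j : 0 <= decay s N k j.
Proof. exact: powR_ge0. Qed.

Lemma decay_sym s N k j : decay s N k j = decay s N j k.
Proof. by rewrite /decay dist_sym. Qed.

Lemma powRN_gt0M c x s : 0 < c -> 0 < x -> c `^ s * (c * x) `^ (- s) = x `^ (- s).
Proof.
move=> c0 x0; rewrite powRM ?ltW// mulrA -powRD ?subrr ?powRr0 ?mul1r//.
by rewrite (gt_eqF c0) implybT.
Qed.

Lemma powRN_le s x y : 0 <= s -> 0 < x -> x <= y -> y `^ (- s) <= x `^ (- s).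
Proof.
move=> s0 x0 xy; have y0 := lt_le_trans x0 xy.
by rewrite !powRN lef_pV2 ?posrE ?powR_gt0// ge0_ler_powR ?nnegrE ?(ltW x0) ?(ltW y0).
Qed.

(** Comparable bases have comparable negative powers; this is the only way in
    which constants such as [2 `^ s] and [3 `^ s] arise below. *)
Lemma powRN_leM c s x y : 0 <= s -> 0 < c -> 0 < x -> x <= c * y ->
  y `^ (- s) <= c `^ s * x `^ (- s).
Proof.
move=> s0 c0 x0 xy.
have y0 : 0 < y by rewrite -(pmulr_rgt0 _ c0); apply: (lt_le_trans _ xy).
by rewrite -(powRN_gt0M s c0 y0) ler_wpM2l ?powR_ge0// powRN_le.
Qed.

Lemma decay_le1 s N k j : 0 <= s -> 0 < N -> decay s N k j <= 1.
Proof.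
move=> s0 N0; have E1 : 1 `^ (- s) = 1 :> R by rewrite powR1.
rewrite -[leRHS]E1 /decay.
by rewrite powRN_le// lerDl divr_ge0 ?dist_ge0 ?ltW.
Qed.

(** From [(1 + x) (1 + y) >= 1 + x + y] and the triangle inequality. *)
Lemma decayM_le s N i j k : 0 <= s -> 0 < N ->
  decay s N i j * decay s N j k <= decay s N i k.
Proof.
move=> s0 N0; rewrite /decay -powRM ?(ltW (base_gt0 _ _ N0))//.
rewrite powRN_le ?base_gt0//.
have := dist_tri i j k; rewrite -(ler_pM2r (x := N^-1)) ?invr_gt0// mulrDl => tri.
have : 0 <= dist i j / N by rewrite divr_ge0 ?dist_ge0 ?ltW.
have : 0 <= dist j k / N by rewrite divr_ge0 ?dist_ge0 ?ltW.
nra.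
Qed.

(** One of [j - i], [j - k] has at least half the length of [i - k], so one of
    the two factors on the left is already of the size of [decay s N i k].
    Summed over [j], this is the stability of polynomial decay under
    convolution. *)
Lemma decayM_leD s N i j k : 0 <= s -> 0 < N ->
  decay s N i j * decay s N j k <=
  2 `^ s * decay s N i k * (decay s N i j + decay s N j k).
Proof.
move=> s0 N0.
have a0 := base_gt0 i j N0; have b0 := base_gt0 j k N0.
have c0 := base_gt0 i k N0.
have tri : 1 + dist i k / N <= 2 * Num.max (1 + dist i j / N) (1 + dist j k / N).
  have := dist_tri i j k; rewrite -(ler_pM2r (x := N^-1)) ?invr_gt0// mulrDl => tri.
  by case: (leP (1 + dist i j / N)) => ?; lra.
move: tri; rewrite /decay; set a := 1 + dist i j / N in a0 *.
set b := 1 + dist j k / N in b0 *; set c := 1 + dist i k / N in c0 *.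
case: (leP a b) => [ab|ba] tri.
- rewrite mulrC mulrDr ler_wpDr ?mulr_ge0 ?powR_ge0// ler_wpM2r ?powR_ge0//.
  exact: powRN_leM (ltr0Sn R 1) c0 tri.
- rewrite mulrDr; apply: ler_wpDl; first by rewrite !mulr_ge0 ?powR_ge0.
  by rewrite ler_wpM2r ?powR_ge0//; apply: powRN_leM (ltr0Sn R 1) c0 tri.
Qed.

(** Bernoulli's inequality for a negative real exponent, from
    [1 + x <= expR x] and [ln t <= t - 1]. *)
Lemma powRN_bernoulli p t : 0 <= p -> 0 < t -> 1 + p * (1 - t) <= t `^ (- p).
Proof.
move=> p0 t0; rewrite /powR gt_eqF//.
apply: le_trans (expR_ge1Dx _); rewrite lerD2l.
have : ln (1 + (t - 1)) <= t - 1 by rewrite le_ln1Dx//; lra.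
have -> : 1 + (t - 1) = t by ring.
by nra.
Qed.

(** The comparison of a sum with an integral, in telescoping form: the right
    side is the integral of [y `^ (- s)] over the step, up to the factor [N]. *)
Lemma powRN_telescope s N x : 1 < s -> 0 < N -> 0 < x ->
  (x + N^-1) `^ (- s) <=
  N / (s - 1) * (x `^ (- (s - 1)) - (x + N^-1) `^ (- (s - 1))).
Proof.
move=> s1 N0 x0; set p := s - 1; set y := x + N^-1.
have p0 : 0 < p by rewrite subr_gt0.
have Ni : 0 < N^-1 by rewrite invr_gt0.
have y0 : 0 < y by rewrite addr_gt0.
have xE : x `^ (- p) = y `^ (- p) * (x / y) `^ (- p).
  by rewrite -powRM ?divr_ge0 ?ltW// mulrC divfK ?gt_eqF.
have yE : y `^ (- s) = y `^ (- p) * y^-1.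
  rewrite -(powR_inv1 (ltW y0)) -powRD ?(gt_eqF y0) ?implybT//.
  by congr (_ `^ _); rewrite /p; ring.
have := powRN_bernoulli (ltW p0) (divr_gt0 x0 y0).
rewrite -(ler_pM2l (powR_gt0 (- p) y0)) -xE yE => b.
rewrite -ler_pdivrMl ?divr_gt0//.
rewrite lerBrDl; apply: le_trans b.
apply: le_of_eq.
by rewrite invf_div /y; field; rewrite !gt_eqF ?ltr_wpDl ?mulr_ge0 ?(ltW x0) ?(ltW N0).
Qed.

(** At scale [N >= 1] the kernel has mass [O(N)]: after the central entry,
    each of the two tails telescopes by [powRN_telescope]. *)
Lemma esum_decay s N n : 1 < s -> 1 <= N ->
  (\esum_(j in [set: int]) (decay s N n j)%:E <= (N * decay_mass s)%:E)%E.
Proof.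
move=> s1 N1; have N0 : 0 < N by apply: (lt_le_trans _ N1).
have s0 : 0 <= s by lra.
pose g (i : nat) := (1 + i%:R / N) `^ (- s).
have g0 (i : nat) : 0 <= g i by exact: powR_ge0.
have tel (m : nat) : \sum_(0 <= i < m) g i.+1 <= N / (s - 1).
  pose h (i : nat) := N / (s - 1) * (1 + i%:R / N) `^ (- (s - 1)).
  apply: (@le_trans _ _ (\sum_(0 <= i < m) (h i - h i.+1))).
    apply: ler_sum => i _.
    have -> : g i.+1 = (1 + i%:R / N + N^-1) `^ (- s).
      by rewrite /g -natr1 mulrDl mul1r addrA.
    have -> : h i.+1 = N / (s - 1) * (1 + i%:R / N + N^-1) `^ (- (s - 1)).
      by rewrite /h -natr1 mulrDl mul1r addrA.
    by rewrite -mulrBr powRN_telescope// ltr_pwDl// divr_ge0// ltW.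
  under eq_bigr do rewrite -opprB.
  rewrite sumrN telescope_sumr// opprB.
  have -> : h 0%N = N / (s - 1) by rewrite /h mul0r addr0 powR1 mulr1.
  by rewrite gerBl mulr_ge0 ?powR_ge0 ?divr_ge0// ?subr_ge0 ltW.
rewrite (@esum_int_split R n); last by move=> i; rewrite lee_fin decay_ge0.
apply: (@le_trans _ _ ((1 + N / (s - 1)) + N / (s - 1))%:E); last first.
  rewrite lee_fin /decay_mass mulrDr mulr1 -addrA lerD//.
  by apply: le_of_eq; field; rewrite gt_eqF ?subr_gt0.
rewrite EFinD; apply: leeD.
- apply: esum_nat_le => [i|m]; first exact: decay_ge0.
  rewrite (eq_bigr g); last first.
    by move=> i _; rewrite /decay /dist opprD addrA subrr sub0r normrN.
  case: m => [|m]; first by rewrite big_geq// addr_ge0// divr_ge0// ?ltW ?subr_gt0.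
  by rewrite big_nat_recl//= lerD// /g mul0r addr0 powR1.
- apply: esum_nat_le => [i|m]; first exact: decay_ge0.
  rewrite (eq_bigr (fun i : nat => g i.+1))//.
  move=> i _; rewrite /decay /dist.
  by have -> : n - (n - i.+1%:Z) = i.+1%:Z by lia.
Qed.
Lemma decay_mass_gt0 s : 1 < s -> 0 < decay_mass s.
Proof. by move=> s1; rewrite /decay_mass addr_gt0// divr_gt0// subr_gt0. Qed.

End Decay.

(** * Tent functions and profiles *)

Section Tent.
Context {R : realType}.
Implicit Types (r d N c : R) (j k m n : int).

Definition tent N n k : R := Num.max 0 (1 - dist n k / N).

Lemma tent_ge0 N n k : 0 <= tent N n k.
Proof. by rewrite /tent le_max lexx. Qed.

Lemma tent_le1 N n k : 0 < N -> tent N n k <= 1.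
Proof. by move=> N0; rewrite /tent ge_max ler01 gerBl divr_ge0 ?dist_ge0// ltW. Qed.

Lemma tent_diag N n : tent N n n = 1.
Proof. by rewrite /tent distxx mul0r subr0; apply/max_idPr. Qed.

Lemma tent_eq0 N n k : 0 < N -> N <= dist n k -> tent N n k = 0.
Proof.
move=> N0 Nk; rewrite /tent; apply/max_idPl.
by rewrite subr_le0 ler_pdivlMr ?mul1r.
Qed.

Lemma tent_dist_le1 N n k j : 0 < N -> `|tent N n k - tent N n j| <= 1.
Proof.
move=> N0; have := tent_ge0 N n k; have := tent_ge0 N n j.
have := tent_le1 n k N0; have := tent_le1 n j N0.
by rewrite ler_norml => *; apply/andP; split; lra.
Qed.

Lemma tent_lip N n k j : 0 < N -> `|tent N n k - tent N n j| <= dist k j / N.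
Proof.
move=> N0; have Ni : 0 < N^-1 by rewrite invr_gt0.
have t1 := @dist_tri R n k j; have t2 := @dist_tri R n j k.
rewrite (dist_sym j k) in t2.
have := ler_wpM2r (ltW Ni) t2; have := ler_wpM2r (ltW Ni) t1; rewrite !mulrDl /tent.
have : 0 <= dist k j / N by rewrite divr_ge0 ?dist_ge0// ltW.
move: (dist k j / N) (dist n j / N) (dist n k / N) => x y z x0 h1 h2 {t1 t2}.
rewrite ler_norml; case: (leP 0 (1 - z)) => ?; case: (leP 0 (1 - y)) => ?;
  by apply/andP; split; lra.
Qed.

(** Points within a bounded multiple of [N] are not seen by the kernel at
    scale [N], up to a constant. *)
Lemma le_decay_near c r N n k : 0 <= r -> 0 < c -> 0 < N ->
  1 + dist n k / N <= c -> 1 <= c `^ r * decay r N n k.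
Proof.
move=> r0 c0 N0 h.
have E1 : 1 `^ (- r) = 1 :> R by rewrite powR1.
rewrite -[leLHS]E1; apply: powRN_leM => //; first exact: base_gt0.
by rewrite mulr1.
Qed.

(** A bound for the commutator of a matrix decaying like [decay r 1] with a
    tent, up to the localization factors at scale [N].  The first summand
    serves entries with [dist k j <= N], where the Lipschitz bound of the tent
    is interpolated to exponent [d]; the second serves the other entries, where
    only the decay of the matrix is available. *)
Definition band r d N k j : R :=
  N `^ (- d) * decay (r - d) 1 k j + N `^ (- r).

Lemma band_ge0 r d N k j : 0 <= band r d N k j.
Proof. by rewrite addr_ge0 ?mulr_ge0 ?powR_ge0 ?decay_ge0. Qed.

Lemma band_sym r d N k j : band r d N k j = band r d N j k.
Proof. by rewrite /band decay_sym. Qed.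

(** The left side vanishes unless one of [k], [j], say [k], lies within [N] of
    [n].  If moreover [dist k j <= N], then [j] lies within [2 N] of [n], and the
    localization factors are harmless.  If [dist k j > N], then [n] is at most
    twice as far from [j] as [k] is, and decay in [k - j] can be traded for decay
    in [n - j] at scale [N]. *)
Lemma tent_commutator r d N n k j : 0 < r -> 0 <= d <= 1 -> 1 <= N ->
  `|tent N n k - tent N n j| * decay r 1 k j <=
  9 `^ r * (decay r N n k * decay r N n j * band r d N k j).
Proof.
move=> r0 /andP[d0 d1] N1; have N0 : 0 < N by apply: lt_le_trans N1.
have Ni : 0 < N^-1 by rewrite invr_gt0.
wlog nkj : k j / (dist n k : R) <= dist n j.
  move=> wl; have [|/ltW] := leP (dist n k : R) (dist n j); first exact: wl.
  by move=> /wl; rewrite distrC decay_sym band_sym [decay r N n j * _]mulrC.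
have [Nk|kN] := leP N (dist n k).
  rewrite !tent_eq0// ?(le_trans Nk)// subrr normr0 mul0r.
  by rewrite !mulr_ge0 ?powR_ge0 ?decay_ge0 ?band_ge0.
have K1 : 1 <= 3 `^ r * decay r N n k.
  apply: le_decay_near => //; first exact: ltW.
  have : dist n k / N < 1 by rewrite ltr_pdivrMr ?mul1r.
  by lra.
have -> : 9 `^ r = 3 `^ r * 3 `^ r :> R.
  by rewrite -powRM//; congr (_ `^ _); ring.
set q := decay r N n k in K1 *; set q' := decay r N n j.
have q'0 : 0 <= q' by exact: decay_ge0.
have c0 : 0 <= 3 `^ r :> R by exact: powR_ge0.
have tri := @dist_tri R n k j.
(* Near entries: [dist / N] lies in [0, 1], so it is at most its power of
   exponent [d]. *)
have [kj|/ltW kj] := leP (dist k j) N.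
- have K2 : 1 <= 3 `^ r * q'.
    apply: le_decay_near => //; first exact: ltW.
    have : dist n j / N <= 2 by rewrite ler_pdivrMr//; lra.
    by lra.
  have main : `|tent N n k - tent N n j| * decay r 1 k j <= band r d N k j.
    apply: (@le_trans _ _ (N `^ (- d) * decay (r - d) 1 k j)); last first.
      by rewrite lerDl powR_ge0.
    have D0 : 0 < 1 + dist k j / 1 :> R := base_gt0 k j ltr01.
    have -> : decay (r - d) 1 k j = (1 + dist k j / 1) `^ d * decay r 1 k j.
      by rewrite /decay opprB powRD// (gt_eqF D0) implybT.
    rewrite mulrA ler_wpM2r ?powR_ge0//.
    apply: le_trans (tent_lip n k j N0) _.
    have [->|kj0] := eqVneq (dist k j : R) 0.
      by rewrite mul0r mulr_ge0 ?powR_ge0.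
    have kjN : 0 < dist k j / N by rewrite divr_gt0// lt_neqAle eq_sym kj0 dist_ge0.
    have kj1 : 0 < dist k j / N <= 1 by rewrite kjN ler_pdivrMr ?mul1r.
    apply: le_trans (ger1_powR kj1 d1) _.
    rewrite -powR_inv1 ?(ltW N0)// powRM ?dist_ge0 ?powR_ge0//.
    rewrite -powRrM mulN1r mulrC ler_wpM2l ?powR_ge0// ge0_ler_powR ?nnegrE ?(ltW D0)//.
    by rewrite divr1 lerDr.
  apply: le_trans main _.
  have := band_ge0 r d N k j; set b := band _ _ _ _ _ => b0.
  have : 1 <= (3 `^ r * q) * (3 `^ r * q') by rewrite mulr_ege1.
  move=> /(ler_wpM2r b0); rewrite mul1r => /le_trans; apply.
  by apply: le_of_eq; ring.
(* Far entries: [1 + dist n j / N <= (3 / N) (1 + dist k j)]. *)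
- apply: (@le_trans _ _ (1 * decay r 1 k j)).
    by rewrite ler_wpM2r ?decay_ge0// tent_dist_le1.
  rewrite mul1r.
  have main : decay r 1 k j <= 3 `^ r * (N `^ (- r) * q').
    have <- : (3 / N) `^ r * q' = 3 `^ r * (N `^ (- r) * q').
      rewrite mulrA; congr (_ * _); rewrite powRM//; last exact: ltW.
      by rewrite -powR_inv1 ?(ltW N0)// -powRrM mulN1r.
    apply: powRN_leM; [exact: ltW|by rewrite mulr_gt0|exact: (base_gt0 n j N0)|].
    rewrite mulrAC ler_pdivlMr// mulrDl mulfVK ?gt_eqF// divr1; lra.
  apply: le_trans main _.
  apply: (@le_trans _ _ ((3 `^ r * q) * (3 `^ r * (N `^ (- r) * q')))).
    by rewrite ler_peMl// !mulr_ge0 ?powR_ge0.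
  rewrite -!mulrA ler_wpM2l// mulrCA ler_wpM2l// ler_wpM2l ?decay_ge0//.
  rewrite mulrC ler_wpM2l// lerDr mulr_ge0 ?powR_ge0//.
Qed.

(** About [N / 2] integers [m] lie in [[j, j + N / 2]], and each of the
    corresponding tents is at least [1 / 2] at [j]. *)
Lemma esum_tent_sqr N j : 1 <= N ->
  ((N / 8)%:E <= \esum_(m in [set: int]) (tent N m j ^+ 2)%:E)%E.
Proof.
move=> N1; have N0 : 0 < N by apply: lt_le_trans N1.
rewrite (@esum_int_split R j); last by move=> m; rewrite lee_fin sqr_ge0.
apply: le_trans (leeDl _ _); last by apply: esum_ge0 => m _; rewrite lee_fin sqr_ge0.
have /andP[p1 p2] : (Num.truncn (N / 2))%:R <= N / 2 < (Num.truncn (N / 2)).+1%:R.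
  by apply: truncn_itv; rewrite divr_ge0// ltW.
set p := Num.truncn (N / 2) in p1 p2.
apply: esum_ge; exists `I_p.+1 => //.
rewrite -fsbig_ord/= sumEFin lee_fin.
apply: (@le_trans _ _ (\sum_(i < p.+1) (1 / 4))).
  by rewrite sumr_const card_ord -[leRHS]mulr_natr; lra.
apply: ler_sum => i _.
have iN : i%:R / N <= 1 / 2.
  rewrite ler_pdivrMr// mulrC mulrA mulr1; apply: le_trans p1.
  by rewrite ler_nat -ltnS.
have t2 : 1 / 2 <= tent N (j + i%:Z) j.
  have ij : dist (j + i%:Z) j = i%:R :> R by rewrite /dist addrC addKr.
  by rewrite /tent ij le_max; apply/orP; right; lra.
by rewrite expr2; nra.
Qed.
End Tent.

Section Profile.
Context {R : realType}.
Variables (r d N a b : R) (l : int).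
Hypotheses (r1 : 1 < r) (N1 : 1 <= N).
Hypotheses (a0 : 0 <= a) (b0 : 0 <= b).
Implicit Types (j k m n : int).

Let N0 : 0 < N. Proof. exact: (lt_le_trans ltr01 N1). Qed.
Let r0 : 0 <= r. Proof. exact: (ltW (lt_trans ltr01 r1)). Qed.

(** The a priori bounds that are iterated: decay away from [l] at scale [N],
    plus a constant that the iteration removes. *)
Definition profile k : R := a * decay r N k l + b.

Definition profile_mass s : R := 2 * 2 `^ s * decay_mass s.

Lemma profile_ge0 k : 0 <= profile k.
Proof. by rewrite addr_ge0// mulr_ge0// decay_ge0. Qed.

(** A profile varies slowly at scale [N]. *)
Lemma decay_profile_le n j : decay r N n j * profile j <= profile n.
Proof.
rewrite /profile mulrDr lerD//; last by rewrite ler_piMl// decay_le1.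
by rewrite mulrCA ler_wpM2l// decayM_le.
Qed.

Lemma decay_profile_leD n j : decay r N n j * profile j <=
  a * (2 `^ r * decay r N n l) * (decay r N n j + decay r N l j) +
  b * decay r N n j.
Proof.
rewrite /profile mulrDr [b * _]mulrC lerD// mulrCA -mulrA ler_wpM2l//.
by rewrite (decay_sym _ _ l j) decayM_leD.
Qed.

Lemma esum_decay_profile n :
  (\esum_(j in [set: int]) (decay r N n j * profile j)%:E <=
   (profile_mass r * N * profile n)%:E)%E.
Proof.
have K0 m j : (0 <= (decay r N m j)%:E :> \bar R)%E by rewrite lee_fin decay_ge0.
set e := a * (2 `^ r * decay r N n l).
have e0 : 0 <= e by rewrite !mulr_ge0 ?powR_ge0 ?decay_ge0.
apply: (@le_trans _ _ (\esum_(j in [set: int]) (e%:E * ((decay r N n j)%:E +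
  (decay r N l j)%:E) + b%:E * (decay r N n j)%:E))%E).
  by apply: le_esum => j _; rewrite -!EFinD lee_fin decay_profile_leD.
rewrite esumD; [|by move=> *; rewrite mule_ge0// adde_ge0|by move=> *; rewrite mule_ge0].
rewrite !esumZl//; last by move=> *; rewrite adde_ge0.
rewrite esumD//.
have S m := esum_decay m r1 N1.
apply: (@le_trans _ _ ((e * (N * decay_mass r + N * decay_mass r) +
  b * (N * decay_mass r))%:E)).
  rewrite EFinD !EFinM; apply: leeD; rewrite lee_wpmul2l ?lee_fin//.
  by rewrite EFinD leeD.
rewrite lee_fin /profile_mass /profile /e.
have := decay_mass_gt0 r1; set s := decay_mass r => s0.
have p1 : 1 <= 2 `^ r :> R by rewrite -[leLHS](powRr0 2) ler_powR// ler1n.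
rewrite -subr_ge0; set w := decay r N n l; set p := 2 `^ r in p1 *.
rewrite [leRHS](_ : _ = b * (s * (N * (2 * p - 1)))); last by ring.
by rewrite !mulr_ge0 ?(ltW s0) ?(ltW N0)//; lra.
Qed.

(** The condition [d <= r - 1] makes [N `^ (- r) * N], the contribution of the
    second summand of [band], at most [N `^ (- d)]. *)
Lemma esum_band_profile n k : 1 < r - d -> d <= r - 1 ->
  (\esum_(j in [set: int]) (band r d N k j * (decay r N n j * profile j))%:E <=
   ((decay_mass (r - d) + profile_mass r) * N `^ (- d) * profile n)%:E)%E.
Proof.
move=> rd1 dr.
pose e := N `^ (- d) * profile n.
have e0 : 0 <= e by rewrite mulr_ge0 ?powR_ge0 ?profile_ge0.
apply: (@le_trans _ _ (\esum_(j in [set: int]) (e%:E * (decay (r - d) 1 k j)%:E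
   + (N `^ (- r))%:E * (decay r N n j * profile j)%:E))%E).
  apply: le_esum => j _; rewrite -!EFinM -EFinD lee_fin /band mulrDl.
  rewrite lerD// /e [leRHS]mulrAC.
  by rewrite ler_wpM2l ?decay_profile_le// mulr_ge0 ?powR_ge0 ?decay_ge0.
have K0 j : (0 <= (decay r N n j * profile j)%:E)%E.
  by rewrite lee_fin mulr_ge0 ?decay_ge0 ?profile_ge0.
have K1 j : (0 <= (decay (r - d) 1 k j)%:E :> \bar R)%E by rewrite lee_fin decay_ge0.
rewrite esumD; try by move=> *; rewrite mule_ge0// lee_fin powR_ge0.
rewrite !esumZl ?powR_ge0//.
apply: (@le_trans _ _ ((e * (1 * decay_mass (r - d)) +
   N `^ (- r) * (profile_mass r * N * profile n))%:E)).
  rewrite EFinD !EFinM; apply: leeD; rewrite lee_wpmul2l ?lee_fin ?powR_ge0//.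
    exact: esum_decay.
  exact: esum_decay_profile.
rewrite lee_fin mul1r /e 2!mulrDl lerD//.
  by apply: le_of_eq; ring.
have pm0 : 0 <= profile_mass r by rewrite !mulr_ge0 ?powR_ge0 ?ltW ?decay_mass_gt0.
have -> : N `^ (- r) * (profile_mass r * N * profile n) =
  profile_mass r * (N `^ (- r) * N) * profile n by ring.
rewrite ler_wpM2r ?profile_ge0// ler_wpM2l//.
rewrite -{2}(powRr1 (ltW N0)) -powRD; last by rewrite (gt_eqF N0) implybT.
by rewrite ler_powR//; lra.
Qed.

(** Passage from the window energies of [F] to a weighted energy.  By
    [esum_tent_sqr] the sum over [j] is at most [8 / N] times its average over
    the windows [m]; inside a window the weight is constant up to [4 `^ r], so
    that the window contributes [decay r N n m / profile m] times
    [profile m ^+ 2], and [esum_decay_profile] sums these up. *)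
Lemma esum_window (F : int -> R) n : (forall k, 0 < profile k) ->
  (forall m, (\esum_(j in [set: int]) ((tent N m j * F j) ^+ 2)%:E <=
              (profile m ^+ 2)%:E)%E) ->
  (\esum_(j in [set: int]) (decay r N n j * (F j ^+ 2 / profile j))%:E <=
   (8 * 4 `^ r * profile_mass r * profile n)%:E)%E.
Proof.
move=> u0 hF.
pose G j := decay r N n j * (F j ^+ 2 / profile j).
have G0 j : 0 <= G j by rewrite mulr_ge0 ?decay_ge0 ?divr_ge0 ?sqr_ge0 ?ltW.
apply: (@le_trans _ _ (\esum_(j in [set: int]) \esum_(m in [set: int])
  ((8 / N * G j)%:E * (tent N m j ^+ 2)%:E))%E).
  apply: le_esum => j _; rewrite esumZl; last 2 first.
    by rewrite mulr_ge0// divr_ge0// ltW.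
    by move=> m; rewrite lee_fin sqr_ge0.
  apply: (@le_trans _ _ ((8 / N * G j)%:E * (N / 8)%:E)%E); last first.
    by rewrite lee_wpmul2l ?esum_tent_sqr// lee_fin mulr_ge0// divr_ge0// ltW.
  rewrite -EFinM lee_fin -/(G j) le_eqVlt; apply/orP; left; apply/eqP.
  by field; rewrite gt_eqF.
rewrite exchange_esum; last first.
  by move=> j m; rewrite -EFinM lee_fin mulr_ge0 ?sqr_ge0// mulr_ge0// divr_ge0// ltW.
pose c := 8 / N * 4 `^ r.
have c0 : 0 <= c by rewrite mulr_ge0 ?powR_ge0// divr_ge0// ltW.
apply: (@le_trans _ _ (\esum_(m in [set: int])
   (c%:E * (decay r N n m * profile m)%:E))%E).
  apply: le_esum => m _.
  pose e := c * decay r N n m / profile m.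
  have e0 : 0 <= e by rewrite !mulr_ge0 ?decay_ge0// invr_ge0 ltW.
  apply: (@le_trans _ _ (\esum_(j in [set: int])
     (e%:E * ((tent N m j * F j) ^+ 2)%:E))%E).
    apply: le_esum => j _; rewrite -!EFinM lee_fin.
    have [mj|jm] := leP N (dist m j); first by rewrite tent_eq0// mul0r !expr0n/= !mulr0.
    rewrite [_ ^+ 2 in leRHS]exprMn [leRHS]mulrCA [leLHS]mulrC ler_wpM2l ?sqr_ge0//.
    rewrite /G /e /c.
    have near : 1 <= 2 `^ r * decay r N m j.
      apply: le_decay_near => //.
      have : dist m j / N < 1 by rewrite ltr_pdivrMr ?mul1r.
      by lra.
    have K1 : decay r N n j <= 2 `^ r * decay r N n m.
      have := decayM_le n j m r0 N0; rewrite (decay_sym _ _ j m) => h.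
      apply: (@le_trans _ _ (2 `^ r * (decay r N n j * decay r N m j))).
        by rewrite mulrCA ler_peMr ?decay_ge0.
      by rewrite ler_wpM2l ?powR_ge0.
    have K2 : (profile j)^-1 <= 2 `^ r / profile m.
      rewrite ler_pdivlMr// mulrC ler_pdivrMr//.
      apply: (@le_trans _ _ (2 `^ r * (decay r N m j * profile m))).
        by rewrite mulrA ler_peMl// ltW.
      by rewrite ler_wpM2l ?powR_ge0// decay_sym decay_profile_le.
    have -> : 4 `^ r = 2 `^ r * 2 `^ r :> R.
      by rewrite -powRM//; congr (_ `^ _); ring.
    have := ler_pM (decay_ge0 r N n j) _ K1 K2.
    rewrite invr_ge0 (ltW (u0 _)) => /(_ isT).
    move=> /(ler_wpM2l (sqr_ge0 (F j))).
    have N8 : 0 <= 8 / N by rewrite divr_ge0// ltW.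
    move=> /(ler_wpM2l N8) h.
    by apply: (le_trans _ (le_trans h _)); apply: le_of_eq; ring.
  rewrite esumZl//; last by move=> j; rewrite lee_fin sqr_ge0.
  apply: (@le_trans _ _ (e%:E * (profile m ^+ 2)%:E)%E); first by rewrite lee_wpmul2l.
  rewrite -!EFinM lee_fin; apply: le_of_eq; rewrite /e; field.
  by rewrite gt_eqF.
rewrite esumZl//; last first.
  by move=> m; rewrite lee_fin mulr_ge0 ?decay_ge0// ltW.
apply: (@le_trans _ _ (c%:E * (profile_mass r * N * profile n)%:E)%E).
  by rewrite lee_wpmul2l// esum_decay_profile.
rewrite -EFinM lee_fin /c; apply: le_of_eq; field.
by rewrite gt_eqF.
Qed.
End Profile.

(** * Operators on l^2 and unconditional sums *)

Section Ell2Glue.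
Context {R : realType}.
Implicit Types (f : ell2 R) (z : R[i]).

Lemma normc_ge0 z : 0 <= normc z.
Proof. by case: z => x y; exact: sqrtr_ge0. Qed.

Lemma normc_real (x : R) : 0 <= x -> normc x%:C%C = x.
Proof. by move=> x0; rewrite /normc/= expr0n addr0 sqrtr_sqr ger0_norm. Qed.

Lemma normE_normc z : `|z| = (normc z)%:C%C.
Proof. by case: z. Qed.

Lemma normc_sum (s : seq int) (g : int -> R[i]) :
  normc (\sum_(i <- s) g i) <= \sum_(i <- s) normc (g i).
Proof.
elim/big_ind2: _ => //; first by rewrite normc0.
by move=> x1 x2 y1 y2 h1 h2; apply: le_trans (le_normcD _ _) _; rewrite lerD.
Qed.

Lemma sqr_sum_ge0 (f : int -> R[i]) : (0 <= sqr_sum f)%E.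
Proof. by apply: esum_ge0 => k _; rewrite lee_fin sqr_ge0. Qed.

Lemma sqr_ell2_norm f : ((ell2_norm f) ^+ 2)%:E = sqr_sum f.
Proof.
have := valP f; rewrite /= inE /= => fin.
rewrite /ell2_norm sqr_sqrtr ?fine_ge0 ?sqr_sum_ge0// fineK//.
by rewrite ge0_fin_numE ?sqr_sum_ge0.
Qed.

Lemma ell2_norm_ge0 f : 0 <= ell2_norm f.
Proof. exact: sqrtr_ge0. Qed.

Lemma ell2_normZ (a : R[i]) f : ell2_norm (a *: f) = normc a * ell2_norm f.
Proof.
apply/eqP; rewrite -(@eqrXn2 _ 2) ?mulr_ge0 ?ell2_norm_ge0 ?normc_ge0//.
apply/eqP/EFin_inj; rewrite exprMn [in RHS]EFinM !sqr_ell2_norm /sqr_sum.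
rewrite -esumZl ?sqr_ge0//; last by move=> k; rewrite lee_fin sqr_ge0.
by apply: eq_esum => k _; rewrite -EFinM -exprMn -normcM.
Qed.

Lemma sqr_sum_delta (l : int) : sqr_sum (fun k => (k == l)%:R : R[i]) = 1%E.
Proof.
rewrite /sqr_sum (esumID [set l]%classic)//; last by move=> k _; rewrite lee_fin sqr_ge0.
rewrite setTI setTI esum_set1 ?lee_fin ?sqr_ge0// [X in (_ + X)%E]esum1.
  by rewrite adde0 eqxx [normc _]normc1 expr1n.
by move=> k /= /eqP/negPf ->; rewrite [normc _]normc0 expr0n.
Qed.

(** Boundedness is what makes the supremum defining [op_norm] meaningful; the
    inequality then follows from the unit ball by homogeneity. *)
Lemma le_op_norm (T : {linear ell2 R -> ell2 R}) f :
  bounded_op T -> ell2_norm (T f) <= op_norm T * ell2_norm f.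
Proof.
move=> [M hM].
have ub g : ell2_norm g <= 1 -> ell2_norm (T g) <= op_norm T.
  move=> g1; apply: ub_le_sup; last by exists g.
  exists `|M| => _ [h /= h1 <-]; apply: le_trans (hM h) _.
  have := ell2_norm_ge0 h; have := ler_norm M; have := normr_ge0 M.
  by nra.
have [f0|fN0] := eqVneq (ell2_norm f) 0.
  by have := hM f; rewrite f0 !mulr0.
have fp : 0 < ell2_norm f by rewrite lt_neqAle eq_sym fN0 ell2_norm_ge0.
have := ub ((ell2_norm f)^-1%:C%C *: f).
rewrite linearZ/= !ell2_normZ normc_real ?invr_ge0 ?ell2_norm_ge0// mulVf//.
by move=> /(_ (lexx _)); rewrite ler_pdivrMl// mulrC.
Qed.

Lemma op_norm_ge0 (T : {linear ell2 R -> ell2 R}) : bounded_op T -> 0 <= op_norm T.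
Proof.
move=> /(le_op_norm (ell2_delta R 0)); rewrite {2}/ell2_norm sqr_sum_delta sqrtr1 mulr1.
by apply: le_trans; exact: ell2_norm_ge0.
Qed.

Lemma ell2_norm_delta (l : int) : ell2_norm (ell2_delta R l) = 1.
Proof. by rewrite /ell2_norm sqr_sum_delta sqrtr1. Qed.

Lemma partial_sumE (g : int -> R[i]) (X : {fset int}) :
  summability.partial_sum g X = \sum_(i <- X) g i.
Proof. by rewrite /summability.partial_sum [RHS]big_seq_fsetE. Qed.

Lemma unconditional_sum_le (g : int -> R[i]) (z : R[i]) (c : R) :
  summability.partial_sum g X @[X --> summability.totally] --> (z : R[i]^o) ->
  (forall X : {fset int}, normc (\sum_(i <- X) g i) <= c) -> normc z <= c.
Proof.
move=> gz gc; apply/ler_addgt0Pr => e e0.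
have eC : 0 < e%:C%C by rewrite ltcR.
have pf := @summability.totally_filter int.
have FF : Filter (@summability.totally int) by apply: filter_filter.
have := (@cvgrPdist_le (R[i] : numFieldType) ((R[i] : numFieldType)^o)
  {fset int} (@summability.totally int) FF (summability.partial_sum g) z).1 gz.
move=> /(_ _ eC) /filter_ex [X].
rewrite normE_normc lecR partial_sumE => ze.
rewrite -[z](subrK (\sum_(i <- X) g i)); apply: le_trans (le_normcD _ _) _.
by rewrite addrC lerD.
Qed.

Lemma unconditional_sumB (g h : int -> R[i]) (y z c : R[i]) :
  summability.partial_sum g X @[X --> summability.totally] --> (y : R[i]^o) ->
  summability.partial_sum h X @[X --> summability.totally] --> (z : R[i]^o) ->
  summability.partial_sum (fun i => g i - c * h i) X @[X --> summability.totally]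
    --> (y - c * z : R[i]^o).
Proof.
move=> gy hz; have pf := @summability.totally_filter int.
have FF : Filter (@summability.totally int) by apply: filter_filter.
rewrite (_ : (fun X => _) = (fun X => summability.partial_sum g X -
    c * summability.partial_sum h X)); last first.
  by apply/funext => X; rewrite !partial_sumE sumrB mulr_sumr.
have cz := @cvgZr (R[i] : numFieldType) ((R[i] : numFieldType)^o) {fset int}
  (@summability.totally int) FF c (summability.partial_sum h) z hz.
exact: (@cvgB (R[i] : numFieldType) ((R[i] : numFieldType)^o) {fset int}
  (@summability.totally int) FF (summability.partial_sum g) _ y _ gy cz).
Qed.

Lemma cauchy_schwarz_seq (s : seq int) (a b c : int -> R) :
  (forall i, 0 <= a i) -> (forall i, 0 <= b i) -> (forall i, 0 <= c i) ->
  (forall i, a i ^+ 2 <= b i * c i) ->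
  (\sum_(i <- s) a i) ^+ 2 <= (\sum_(i <- s) b i) * (\sum_(i <- s) c i).
Proof.
move=> a0 b0 c0 abc; elim: s => [|i s IH]; first by rewrite !big_nil expr0n mulr0.
rewrite !big_cons.
set A := \sum_(j <- s) a j in IH *; set B := \sum_(j <- s) b j in IH *.
set D := \sum_(j <- s) c j in IH *.
have A0 : 0 <= A by exact: sumr_ge0.
have B0 : 0 <= B by exact: sumr_ge0.
have D0 : 0 <= D by exact: sumr_ge0.
have cross : 2 * (a i * A) <= b i * D + c i * B.
  rewrite -(@ler_pXn2r _ 2) ?nnegrE ?mulr_ge0 ?addr_ge0 ?mulr_ge0//.
  have h : (a i * A) ^+ 2 <= (b i * c i) * (B * D).
    by rewrite exprMn ler_pM ?sqr_ge0.
  have := sqr_ge0 (b i * D - c i * B); move: h; rewrite !expr2.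
  nra.
by have := abc i; rewrite !expr2 in IH *; nra.
Qed.

(** One row of a Schur test: Cauchy-Schwarz on every finite partial sum, passed
    to the limit.  The right side may be infinite. *)
Lemma unconditional_sum_schur (g : int -> R[i]) (z : R[i]) (b c : int -> R) (P : R) :
  summability.partial_sum g X @[X --> summability.totally] --> (z : R[i]^o) ->
  (forall i, 0 <= b i) -> (forall i, 0 <= c i) -> 0 < P ->
  (forall i, normc (g i) ^+ 2 <= b i * c i) ->
  (\esum_(i in [set: int]) (b i)%:E <= P%:E)%E ->
  ((normc z ^+ 2)%:E <= P%:E * \esum_(i in [set: int]) (c i)%:E)%E.
Proof.
move=> gz b0 c0 P0 gbc bP.
set Q := (\esum_(i in [set: int]) (c i)%:E)%E.
have Q0 : (0 <= Q)%E by apply: esum_ge0 => i _; rewrite lee_fin.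
have [->|Qfin] := eqVneq Q +oo%E; first by rewrite gt0_muley ?lte_fin// leey.
have QE : Q = (fine Q)%:E by rewrite fineK// ge0_fin_numE// ltey.
have y0 : 0 <= fine Q by exact: fine_ge0.
have fin_le (d : int -> R) (x : R) (X : {fset int}) : (forall i, 0 <= d i) ->
    (\esum_(i in [set: int]) (d i)%:E <= x%:E)%E -> \sum_(i <- X) d i <= x.
  move=> d0; rewrite -lee_fin -sumEFin; apply: le_trans.
  apply: esum_ge; exists [set` X]%classic; first by split=> //; exact: finite_fset.
  by rewrite -fsbig_seq ?fset_uniq.
rewrite QE -EFinM lee_fin -[leRHS]sqr_sqrtr ?mulr_ge0 ?(ltW P0)//.
rewrite ler_pXn2r ?nnegrE ?normc_ge0 ?sqrtr_ge0//.
apply: unconditional_sum_le gz _ => X.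
apply: le_trans (normc_sum _ _) _.
rewrite -(@ler_pXn2r _ 2) ?nnegrE ?sqrtr_ge0 ?sumr_ge0// => [|i _]; last exact: normc_ge0.
rewrite sqr_sqrtr ?mulr_ge0 ?(ltW P0)//.
apply: le_trans (cauchy_schwarz_seq _ _ b0 c0 gbc) _; first by move=> i; exact: normc_ge0.
by apply: ler_pM; rewrite ?sumr_ge0// fin_le// -QE.
Qed.
End Ell2Glue.

(** * Localization of the commutator *)

Section Cutoff.
Context {R : realType}.
Implicit Types (f : ell2 R) (n : int) (N : R).

Fact cutoff_subproof N n f : 0 < N ->
  (fun k => (tent N n k)%:C%C * f k) \in @square_summable R.
Proof.
move=> N0; rewrite inE /=; apply: le_lt_trans (_ : (sqr_sum f < +oo)%E).
  apply: le_esum => k _; rewrite lee_fin normcM normc_real ?tent_ge0// exprMn.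
  by rewrite ler_piMl ?sqr_ge0// exprn_ile1 ?tent_ge0 ?tent_le1.
by have := valP f; rewrite /= inE.
Qed.

Definition cutoff N (N0 : 0 < N) n f : ell2 R := Ell2 (cutoff_subproof n f N0).

Lemma sqr_sum_cutoff N (N0 : 0 < N) n f : sqr_sum (cutoff N0 n f) =
  \esum_(k in [set: int]) ((tent N n k * normc (f k)) ^+ 2)%:E.
Proof.
by apply: eq_esum => k _; rewrite /= normcM normc_real ?tent_ge0.
Qed.
End Cutoff.

Section Localization.
Context {R : realType}.
Variables (r d N : R) (A : int -> int -> R[i]) (C : R) (S : ell2 R -> ell2 R).
Hypotheses (r1 : 1 < r) (d01 : 0 <= d <= 1) (rd1 : 1 < r - d) (dr : d <= r - 1).
Hypotheses (N1 : 1 <= N) (N0 : 0 < N).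
Hypotheses (AC : off_diagonal_decay r A C) (AS : acts_as A S).

Let r0 : 0 <= r. Proof. exact: (ltW (lt_trans ltr01 r1)). Qed.
Let r0' : 0 < r. Proof. exact: (lt_trans ltr01 r1). Qed.

Definition commutator_mass (s e : R) : R := decay_mass (s - e) + profile_mass s.
Definition window_mass (s : R) : R := 8 * 4 `^ s * profile_mass s.

Lemma decay_constant_ge0 : 0 <= C.
Proof.
have := AC 0 0; rewrite subrr normr0 addr0 powR1 mulr1.
by apply: le_trans; exact: normc_ge0.
Qed.

Lemma commutator_entry n k j :
  normc (A k j) * `|tent N n k - tent N n j| <=
  C * 9 `^ r * (decay r N n k * decay r N n j * band r d N k j).
Proof.
apply: (@le_trans _ _ (C * (`|tent N n k - tent N n j| * decay r 1 k j))).
  rewrite mulrCA mulrC ler_wpM2l//.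
  by apply: le_trans (AC k j) _; rewrite /decay divr1.
rewrite -mulrA ler_wpM2l ?decay_constant_ge0//.
exact: tent_commutator.
Qed.

(** The column estimate of the Schur test, which is [esum_band_profile] for the
    constant profile 1. *)
Lemma esum_band_sqr n j :
  (\esum_(k in [set: int]) (band r d N k j * decay r N n k ^+ 2)%:E <=
   (commutator_mass r d * N `^ (- d))%:E)%E.
Proof.
have := @esum_band_profile R r d N 0 1 0 r1 N1 (lexx _) ler01 n j rd1 dr.
rewrite /profile mul0r add0r mulr1; apply: le_trans; apply: le_esum => k _.
rewrite mul0r add0r mulr1 lee_fin band_sym ler_wpM2l ?band_ge0//.
by rewrite expr2 ler_piMr ?decay_ge0// decay_le1.
Qed.

(** The expression under the norm is the [k]-th entry of the commutator of [A]
    with the tent, applied to [f].  By [commutator_entry] its [j]-th summand is at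
    most [D q_k q_j band F_j], with [D = C 9^r], [q = decay r N n], [F_j] the
    modulus of [f j] and [u] the profile.  This is the geometric mean of
    [band q_j u_j], whose sum over [j] is at most a multiple of [N^-d u_n], and
    of [D^2 q_k^2 band q_j F_j^2 / u_j], which is summed over [k] first. *)
Lemma commutator_energy (a b : R) (l n : int) (f : ell2 R) :
  0 <= a -> 0 <= b -> (forall m, 0 < profile r N a b l m) ->
  (forall m, (sqr_sum (cutoff N0 m f) <= (profile r N a b l m ^+ 2)%:E)%E) ->
  (\esum_(k in [set: int])
     (normc (S (cutoff N0 n f) k - (tent N n k)%:C%C * S f k) ^+ 2)%:E <=
   (window_mass r * (C * 9 `^ r * commutator_mass r d * N `^ (- d)) ^+ 2 *
    profile r N a b l n ^+ 2)%:E)%E.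
Proof.
move=> a0 b0 u0 fu; set u := profile r N a b l in u0 fu *.
pose F j := normc (f j).
pose D := C * 9 `^ r.
pose B := commutator_mass r d * N `^ (- d).
have D0 : 0 <= D by rewrite mulr_ge0 ?powR_ge0 ?decay_constant_ge0.
have B0 : 0 < B.
  rewrite mulr_gt0 ?powR_gt0// addr_gt0 ?decay_mass_gt0//.
  by rewrite !mulr_gt0 ?powR_gt0 ?decay_mass_gt0.
pose E j := D ^+ 2 * (decay r N n j * (F j ^+ 2 / u j)).
have G0 j : 0 <= decay r N n j * (F j ^+ 2 / u j).
  by rewrite mulr_ge0 ?decay_ge0// divr_ge0 ?sqr_ge0// ltW.
have E0 j : 0 <= E j by rewrite mulr_ge0 ?sqr_ge0.
pose c k j := E j * (band r d N k j * decay r N n k ^+ 2).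
have c0 k j : 0 <= c k j by rewrite mulr_ge0// mulr_ge0 ?band_ge0 ?sqr_ge0.
have row k : ((normc (S (cutoff N0 n f) k - (tent N n k)%:C%C * S f k) ^+ 2)%:E <=
    (B * u n)%:E * \esum_(j in [set: int]) (c k j)%:E)%E.
  have cv := unconditional_sumB (c := (tent N n k)%:C%C)
    (@AS (cutoff N0 n f) k) (@AS f k).
  apply: (unconditional_sum_schur cv
    (b := fun j => band r d N k j * (decay r N n j * u j))) => //.
  - by move=> j; rewrite !mulr_ge0 ?band_ge0 ?decay_ge0// ltW.
  - by rewrite mulr_gt0.
  - move=> j /=.
    have -> : A k j * ((tent N n j)%:C%C * f j) - (tent N n k)%:C%C * (A k j * f j)
        = A k j * (tent N n j - tent N n k)%:C%C * f j.
      by rewrite rmorphB/=; ring.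
    have -> : band r d N k j * (decay r N n j * u j) * c k j =
        (D * (decay r N n k * decay r N n j * band r d N k j) * F j) ^+ 2.
      rewrite /c /E; field; rewrite gt_eqF//.
    rewrite ler_pXn2r ?nnegrE ?normc_ge0 ?mulr_ge0 ?decay_ge0 ?band_ge0
      ?normc_ge0 ?powR_ge0 ?decay_constant_ge0//.
    rewrite !normcM ler_wpM2r ?normc_ge0//.
    apply: le_trans (commutator_entry n k j).
    rewrite ler_wpM2l ?normc_ge0// [leRHS]distrC.
    by rewrite /normc/= expr0n addr0 sqrtr_sqr.
  - exact: esum_band_profile.
apply: (@le_trans _ _ ((B * u n)%:E *
    \esum_(k in [set: int]) \esum_(j in [set: int]) (c k j)%:E)%E).
  rewrite -esumZl; first by apply: le_esum => k _; exact: row.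
    by rewrite mulr_ge0// ltW.
  by move=> k; apply: esum_ge0 => j _; rewrite lee_fin.
rewrite exchange_esum; last by move=> k j; rewrite lee_fin.
have cols : (\esum_(j in [set: int]) \esum_(k in [set: int]) (c k j)%:E <=
    (B * D ^+ 2 * (window_mass r * u n))%:E)%E.
  apply: (@le_trans _ _ (\esum_(j in [set: int])
      ((B * D ^+ 2)%:E * (decay r N n j * (F j ^+ 2 / u j))%:E))%E).
    apply: le_esum => j _.
    apply: (@le_trans _ _ ((E j)%:E * B%:E)%E).
      rewrite /c; under eq_esum do rewrite EFinM.
      rewrite esumZl//; last by move=> k; rewrite lee_fin mulr_ge0 ?band_ge0 ?sqr_ge0.
      by rewrite lee_wpmul2l ?lee_fin// esum_band_sqr.
    by rewrite -!EFinM lee_fin /E; apply: le_of_eq; ring.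
  have BD0 : 0 <= B * D ^+ 2 by rewrite mulr_ge0 ?sqr_ge0 ?(ltW B0).
  rewrite esumZl//.
  rewrite [leRHS]EFinM lee_wpmul2l ?lee_fin//.
  apply: esum_window => // m.
  by rewrite -sqr_sum_cutoff.
apply: le_trans (lee_wpmul2l _ cols) _; first by rewrite lee_fin mulr_ge0// ltW.
by rewrite -EFinM lee_fin /B /D; apply: le_of_eq; ring.
Qed.
End Localization.

(** * Off-diagonal decay of one column of the inverse *)

Section Column.
Context {R : realType}.
Variables (r d N : R) (A : int -> int -> R[i]) (C : R).
Variables (S : ell2 R -> ell2 R) (T : {linear ell2 R -> ell2 R}) (l : int).
Hypotheses (r1 : 1 < r) (d01 : 0 <= d <= 1) (rd1 : 1 < r - d) (dr : d <= r - 1).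
Hypotheses (N1 : 1 <= N) (N0 : 0 < N).
Hypotheses (AC : off_diagonal_decay r A C) (AS : acts_as A S).
Hypotheses (Tb : bounded_op T) (ST : cancel S T) (TS : cancel T S).

Let M := op_norm T.
Let M0 : 0 <= M. Proof. exact: op_norm_ge0. Qed.
Let r0 : 0 <= r. Proof. exact: (ltW (lt_trans ltr01 r1)). Qed.
Let f := T (ell2_delta R l).

Lemma sqr_sum_le_op_norm (g : ell2 R) :
  (sqr_sum g <= (M ^+ 2)%:E * sqr_sum (S g))%E.
Proof.
rewrite -!sqr_ell2_norm -EFinM lee_fin -exprMn.
rewrite ler_pXn2r ?nnegrE ?mulr_ge0 ?ell2_norm_ge0//.
by rewrite -{1}(ST g) le_op_norm.
Qed.

Lemma normcD_sqr (x y : R[i]) :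
  normc (x + y) ^+ 2 <= 2 * normc x ^+ 2 + 2 * normc y ^+ 2.
Proof.
have h := le_normcD x y; have x0 := normc_ge0 (x + y).
apply: (@le_trans _ _ ((normc x + normc y) ^+ 2)).
  by rewrite ler_pXn2r ?nnegrE ?addr_ge0 ?normc_ge0.
by have := sqr_ge0 (normc x - normc y); rewrite !expr2; nra.
Qed.

(** [A] maps [psi f] to the sum of [psi(l) e_l] and the commutator
    applied to [f]. *)
Lemma cutoff_energy n :
  (sqr_sum (cutoff N0 n f) <= (M ^+ 2)%:E *
    (2%:E * (\esum_(k in [set: int])
       (normc (S (cutoff N0 n f) k - (tent N n k)%:C%C * S f k) ^+ 2)%:E) +
     (2 * tent N n l ^+ 2)%:E))%E.
Proof.
apply: le_trans (sqr_sum_le_op_norm _) _.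
rewrite lee_wpmul2l ?lee_fin ?sqr_ge0//.
set h := fun k => S (cutoff N0 n f) k - (tent N n k)%:C%C * S f k.
apply: (@le_trans _ _ (\esum_(k in [set: int]) (2%:E * (normc (h k) ^+ 2)%:E +
   (2 * tent N n l ^+ 2)%:E * (normc ((k == l)%:R : R[i]) ^+ 2)%:E))%E).
  apply: le_esum => k _; rewrite -!EFinM -EFinD lee_fin.
  have -> : S (cutoff N0 n f) k = h k + (tent N n k)%:C%C * S f k.
    by rewrite /h subrK.
  apply: le_trans (normcD_sqr _ _) _; rewrite lerD2l.
  rewrite TS/= normcM normc_real ?tent_ge0// exprMn.
  have [->|kl] := eqVneq k l; first by rewrite mulrA.
  by rewrite [normc _]normc0 expr0n/= !mulr0.
rewrite esumD; last 2 first.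
- by move=> k _; rewrite -EFinM lee_fin mulr_ge0 ?sqr_ge0.
- by move=> k _; rewrite -EFinM lee_fin !mulr_ge0 ?sqr_ge0 ?normc_ge0 ?tent_ge0.
rewrite !esumZl ?mulr_ge0 ?tent_ge0//; try by move=> k; rewrite lee_fin sqr_ge0.
have := sqr_sum_delta (R := R) l; rewrite /sqr_sum => ->.
by rewrite mule1.
Qed.

Hypothesis M_gt0 : 0 < M.
(* The scale [N] is so large that the commutator costs at most half of the
   profile. *)
Hypothesis contraction : 8 * window_mass r *
  (M * (C * 9 `^ r * commutator_mass r d * N `^ (- d))) ^+ 2 <= 1.

Let a := 4 * 2 `^ r * M.

(** With [w = decay r N n l], the energy is at most [(a w + b)^2 / 4] from the
    commutator plus [(a w)^2 / 8] from the right side [e_l]; the sum is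
    at most [(a w + b / 2)^2]. *)
Lemma cutoff_contraction (b : R) n : 0 <= b ->
  (forall m, (sqr_sum (cutoff N0 m f) <= (profile r N a b l m ^+ 2)%:E)%E) ->
  (sqr_sum (cutoff N0 n f) <= (profile r N a (b / 2) l n ^+ 2)%:E)%E.
Proof.
move=> b0 fu.
have a_gt0 : 0 < a by rewrite !mulr_gt0 ?powR_gt0.
have u0 m : 0 < profile r N a b l m.
  by rewrite ltr_pwDl// mulr_gt0 ?decay_gt0.
have a0 := ltW a_gt0.
apply: le_trans (cutoff_energy n) _.
have := commutator_energy r1 d01 rd1 dr N1 AC AS n a0 b0 u0 fu.
set e := esum _ _; set K := window_mass r * _ ^+ 2; set u := profile r N a b l n => en.
apply: (@le_trans _ _ ((M ^+ 2)%:E * (2%:E * (K * u ^+ 2)%:E + (2 * tent N n l ^+ 2)%:E))%E).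
  by rewrite lee_wpmul2l ?lee_fin ?sqr_ge0// leeD2r// lee_wpmul2l ?lee_fin.
rewrite -!EFinM lee_fin.
set w := decay r N n l; set p : R := 2 `^ r.
have w0 : 0 <= w by exact: decay_ge0.
have tw : tent N n l <= p * w.
  have [nl|nl] := leP N (dist n l).
    by rewrite tent_eq0// mulr_ge0 ?powR_ge0.
  apply: le_trans (tent_le1 _ _ N0) _; apply: le_decay_near => //.
  have : dist n l / N < 1 by rewrite ltr_pdivrMr ?mul1r.
  by lra.
have uE : u = a * w + b by [].
have -> : profile r N a (b / 2) l n = a * w + b / 2 by [].
have K8 : 8 * (M ^+ 2 * K) <= 1.
  by apply: le_trans contraction; apply: le_of_eq; rewrite /K; ring.
have h1 : M ^+ 2 * (2 * (K * u ^+ 2)) <= u ^+ 2 / 4.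
  have := ler_wpM2r (sqr_ge0 u) K8; lra.
have h2 : M ^+ 2 * (2 * tent N n l ^+ 2) <= (a * w) ^+ 2 / 8.
  have : tent N n l ^+ 2 <= (p * w) ^+ 2.
    by rewrite ler_pXn2r ?nnegrE ?tent_ge0 ?mulr_ge0 ?powR_ge0.
  move/(ler_wpM2l (sqr_ge0 M)); rewrite /a -/p.
  have -> : (4 * p * M * w) ^+ 2 / 8 = 2 * (M ^+ 2 * (p * w) ^+ 2) by field.
  lra.
rewrite mulrDr; apply: le_trans (lerD h1 h2) _; rewrite uE.
have aw0 : 0 <= a * w by rewrite mulr_ge0.
have := mulr_ge0 aw0 b0; have := sqr_ge0 (a * w).
move: (a * w) => x; rewrite !expr2; lra.
Qed.

Lemma cutoff_iterate (i : nat) : forall n : int,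
  (sqr_sum (cutoff N0 n f) <= (profile r N a (M / 2 ^+ i) l n ^+ 2)%:E)%E.
Proof.
elim: i => [|i IH] n; last first.
  have -> : M / 2 ^+ i.+1 = M / 2 ^+ i / 2 by rewrite exprS; field; rewrite expf_neq0.
  by apply: cutoff_contraction => //; rewrite divr_ge0 ?exprn_ge0.
apply: (@le_trans _ _ (sqr_sum f)).
  apply: le_esum => k _; rewrite lee_fin /= normcM normc_real ?tent_ge0// exprMn.
  by rewrite ler_piMl ?sqr_ge0// exprn_ile1 ?tent_ge0 ?tent_le1.
rewrite -sqr_ell2_norm lee_fin ler_pXn2r ?nnegrE ?ell2_norm_ge0//; last first.
  by rewrite profile_ge0 ?divr_ge0 ?exprn_ge0// !mulr_ge0 ?powR_ge0.
have := le_op_norm (ell2_delta R l) Tb; rewrite ell2_norm_delta mulr1.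
move=> /le_trans; apply; rewrite /profile expr0 divr1 lerDr.
by rewrite !mulr_ge0 ?powR_ge0 ?decay_ge0.
Qed.

Lemma column_decay (k : int) : normc (f k) <= a * decay r N k l.
Proof.
have le_iter (i : nat) : normc (f k) <= a * decay r N k l + M / 2 ^+ i.
  have p0 : 0 <= profile r N a (M / 2 ^+ i) l k.
    by rewrite profile_ge0 ?divr_ge0 ?exprn_ge0// !mulr_ge0 ?powR_ge0.
  rewrite -[leRHS]/(profile r N a (M / 2 ^+ i) l k).
  rewrite -(@ler_pXn2r _ 2) ?nnegrE ?normc_ge0// -lee_fin.
  apply: le_trans (cutoff_iterate i k); rewrite sqr_sum_cutoff.
  apply: esum_ge; exists [set k]; first by split=> //; exact: finite_set1.
  by rewrite fsbig_set1 tent_diag mul1r.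
apply/ler_addgt0Pr => e e0.
have [i hi] : exists i : nat, M / 2 ^+ i <= e.
  exists (Num.truncn (M / e)).+1.
  have M_e : M / e < (Num.truncn (M / e)).+1%:R by exact: truncnS_gt.
  rewrite ler_pdivrMr ?exprn_gt0// mulrC -ler_pdivrMr//.
  apply: le_trans (ltW M_e) _.
  by rewrite -natrX ler_nat ltnW// ltn_expl.
by apply: le_trans (le_iter i) _; rewrite lerD2l.
Qed.
End Column.

(** * Choice of the scale and the main estimate *)

Section Constants.
Context {R : realType}.

Lemma normc_acts_as_delta (A : int -> int -> R[i]) (S : ell2 R -> ell2 R) :
  acts_as A S -> forall k l, normc (S (ell2_delta R l) k) <= normc (A k l).
Proof.
move=> AS k l; apply: unconditional_sum_le (AS (ell2_delta R l) k) _ => X.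
have [lX|lX] := boolP (l \in X); last first.
  rewrite big1_seq ?normc0 ?normc_ge0// => j /= jX.
  have [jl|/negPf jl] := eqVneq j l; first by rewrite -jl jX in lX.
  by rewrite mulr0.
rewrite (big_fsetD1 l)//= eqxx mulr1 big1_seq ?addr0// => j /=.
by rewrite in_fsetD1 => /andP[/negPf -> _]; rewrite mulr0.
Qed.

(** Applying [T] to [S e_0], the zeroth column of [A], gives
    [1 <= op_norm T * |S e_0|], and the norm of that column is controlled by
    [C]. *)
Lemma norm_product_ge (r : R) (A : int -> int -> R[i]) (C : R)
    (S : ell2 R -> ell2 R) (T : {linear ell2 R -> ell2 R}) :
  1 < r -> off_diagonal_decay r A C -> acts_as A S -> bounded_op T ->
  cancel S T -> 1 <= C * op_norm T * decay_mass r.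
Proof.
move=> r1 AC AS Tb ST; set M := op_norm T; set s := decay_mass r.
have C0 := decay_constant_ge0 AC.
have M0 : 0 <= M := op_norm_ge0 Tb.
have s1 : 1 <= s by rewrite lerDl divr_ge0 ?subr_ge0 ?(ltW r1).
have col k : normc (S (ell2_delta R 0) k) <= C * decay r 1 k 0.
  apply: le_trans (normc_acts_as_delta AS k 0) _.
  by apply: le_trans (AC k 0) _; rewrite /decay divr1.
have energy : (sqr_sum (S (ell2_delta R 0)) <= (C ^+ 2 * s)%:E)%E.
  apply: (@le_trans _ _ (\esum_(k in [set: int]) ((C ^+ 2)%:E * (decay r 1 0 k)%:E))%E).
    apply: le_esum => k _; rewrite -EFinM lee_fin.
    apply: (@le_trans _ _ ((C * decay r 1 k 0) ^+ 2)).
      by rewrite ler_pXn2r ?nnegrE ?normc_ge0 ?mulr_ge0 ?decay_ge0.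
    rewrite exprMn ler_wpM2l ?sqr_ge0// (decay_sym _ _ 0) expr2.
    by rewrite ler_piMl ?decay_ge0// decay_le1//; lra.
  rewrite esumZl ?sqr_ge0//; last by move=> k; rewrite lee_fin decay_ge0.
  rewrite [leRHS]EFinM lee_wpmul2l ?lee_fin ?sqr_ge0//.
  by have := esum_decay 0 r1 (lexx 1); rewrite mul1r.
have := sqr_sum_le_op_norm Tb ST (ell2_delta R 0).
rewrite [X in (X <= _)%E](sqr_sum_delta 0).
move=> /le_trans /(_ (lee_wpmul2l _ energy)).
rewrite lee_fin sqr_ge0 -EFinM lee_fin => /(_ isT) h.
rewrite -(@ler_pXn2r _ 2) ?nnegrE ?mulr_ge0 ?(le_trans _ s1)// expr1n.
apply: le_trans h _; rewrite !exprMn mulrCA mulrA ler_wpM2l ?mulr_ge0 ?sqr_ge0//.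
by rewrite expr2 ler_peMr// (le_trans _ s1).
Qed.

(** The scale is [N] with [N `^ d = scale_constant r d * (C * M)].  The last
    factor absorbs [window_mass], since [8 W <= (8 W + 1) ^+ 2]. *)
Definition scale_constant (r d : R) : R :=
  9 `^ r * commutator_mass r d * (8 * window_mass r + 1).
End Constants.

Unset Implicit Arguments.

Theorem theorem1p2 (R : realType) (r : R) (hr : 1 < r) :
  exists2 Cr : R, 0 < Cr &
    forall (A : int -> int -> R[i]) (C : R) (Ainv : {linear ell2 R -> ell2 R}),
      minimal_decay_constant r A C ->
      bounded_inverse A Ainv ->
      forall k l : int,
        normc (op_entry Ainv k l) <=
          Cr * C `^ (2 * r + 2 + 2 / (r - 1))
             * op_norm Ainv `^ (2 * r + 3 + 2 / (r - 1))
             * (1 + `|k - l|%:~R) `^ (- r).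
Proof.
have r0 : 0 < r by exact: lt_trans hr.
have r10 : 0 < r - 1 by rewrite subr_gt0.
pose d := (r - 1) / (2 * r).
have d0 : 0 < d by rewrite divr_gt0// mulr_gt0.
have d12 : d <= 1 / 2 by rewrite ler_pdivrMr ?mulr_gt0//; lra.
have dr1 : d < r - 1.
  by rewrite ltr_pdivrMr ?mulr_gt0// -subr_gt0; have := mulr_gt0 r10 r10; nra.
have d01 : 0 <= d <= 1 by apply/andP; split; lra.
have rd1 : 1 < r - d by lra.
have dr : d <= r - 1 by exact: ltW.
pose q := scale_constant r d.
pose e := 2 * r + 2 + 2 / (r - 1).
have s1 : 1 <= decay_mass r by rewrite lerDl divr_ge0 ?subr_ge0 ?(ltW hr).
have sd0 : 0 < decay_mass (r - d) by exact: decay_mass_gt0.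
have p1 (x : R) : 1 <= x -> 1 <= x `^ r.
  by move=> x1; rewrite -[leLHS](powRr0 x) ler_powR// ltW.
have pm1 : decay_mass r <= profile_mass r.
  by rewrite ler_peMl ?(le_trans _ s1)//; have := p1 2; rewrite ler1n => /(_ isT); lra.
have wm0 : 0 <= window_mass r.
  by rewrite !mulr_ge0 ?powR_ge0// (le_trans _ s1).
have cm1 : decay_mass r <= commutator_mass r d by rewrite /commutator_mass; lra.
have q1 : decay_mass r <= q.
  rewrite /q /scale_constant; apply: (le_trans cm1).
  rewrite -mulrA mulrCA ler_peMr ?mulr_ege1 ?p1 ?ler1n//.
    by rewrite (le_trans _ cm1)// (le_trans _ s1).
  by rewrite lerDr mulr_ge0.
have q0 : 0 < q by apply: lt_le_trans q1; apply: lt_le_trans s1.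
exists (4 * 2 `^ r * q `^ e); first by rewrite !mulr_gt0 ?powR_gt0.
move=> A C T [AC _] [Tb [S [AS ST TS]]] k l; set M := op_norm T.
have kap := norm_product_ge hr AC AS Tb ST.
have C0 := decay_constant_ge0 AC.
have M0 : 0 <= M := op_norm_ge0 Tb.
have CM0 : 0 <= C * M by rewrite mulr_ge0.
have qCM1 : 1 <= q * (C * M).
  by apply: le_trans kap _; rewrite mulrC ler_wpM2r.
pose N := (q * (C * M)) `^ (d^-1).
have N1 : 1 <= N.
  by rewrite -[leLHS](powRr0 (q * (C * M))) ler_powR// invr_ge0 ltW.
have N0 : 0 < N by apply: lt_le_trans N1.
have NM : N `^ (- d) = (q * (C * M))^-1.
  by rewrite -powRrM mulrN mulVf ?gt_eqF// powR_inv1// (le_trans _ qCM1).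
have CM_neq0 : C * M != 0.
  by apply/eqP => CM; move: qCM1; rewrite CM mulr0 ler10.
have M_gt0 : 0 < M.
  by rewrite lt_neqAle M0 andbT eq_sym; apply: contraNneq CM_neq0 => ->; rewrite mulr0.
have contraction : 8 * window_mass r *
    (M * (C * 9 `^ r * commutator_mass r d * N `^ (- d))) ^+ 2 <= 1.
  set W := window_mass r in wm0 *.
  have -> : M * (C * 9 `^ r * commutator_mass r d * N `^ (- d)) = (8 * W + 1)^-1.
    rewrite NM /q /scale_constant -/W.
    have : 9 `^ r != 0 :> R by rewrite gt_eqF ?powR_gt0.
    have : commutator_mass r d != 0.
      by rewrite gt_eqF// (lt_le_trans _ cm1)// (lt_le_trans _ s1).
    move: (9 `^ r) (commutator_mass r d) CM_neq0 => x y.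
    rewrite mulf_eq0 negb_or => /andP[Cn Mn] yn xn.
    by field; rewrite Cn Mn xn yn gt_eqF//; lra.
  rewrite exprVn ler_pdivrMr ?mul1r ?exprn_gt0//; last by lra.
  by rewrite expr2; nra.
have main := column_decay l hr d01 rd1 dr N1 N0 AC AS Tb ST TS M_gt0 contraction k.
apply: le_trans main _.
have tail : decay r N k l <= N `^ r * (1 + `|k - l|%:~R) `^ (- r).
  have D0 : 0 <= dist k l :> R by exact: dist_ge0.
  apply: powRN_leM; [exact: ltW|by []|by rewrite ltr_pwDl|].
  by rewrite mulrDr mulr1 mulrCA mulfV ?gt_eqF// mulr1 lerD2r.
apply: (@le_trans _ _ (4 * 2 `^ r * M * (N `^ r * (1 + `|k - l|%:~R) `^ (- r)))).
  by rewrite ler_wpM2l// !mulr_ge0 ?powR_ge0.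
apply: le_of_eq.
have -> : N `^ r = q `^ e * (C `^ e * M `^ e).
  rewrite -powRrM (powRM _ (ltW q0))// (powRM _ C0)//.
  suff -> : d^-1 * r = e by [].
  by rewrite /d /e; field; rewrite !gt_eqF//; lra.
have -> : 2 * r + 3 + 2 / (r - 1) = e + 1 by rewrite /e; ring.
rewrite -/e (@powRD _ M e 1) ?(gt_eqF M_gt0) ?implybT// powRr1//.
ring.
Qed.
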